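(* Let $(X,\mathcal{F})$ and $(Y,\mathcal{G})$ be two generic dynamical systems. Suppose there exists a semiconjugacy from $(X,\mathcal{F})$ to $(Y,\mathcal{G})$. If $(X,\mathcal{F})$ is topologically transitive or strongly transitive, then $(Y,\mathcal{G})$ satisfies the corresponding property.
   Context: A generic dynamical system (GDS) is a pair $(X,\mathcal{F})$ where $X$ is a compact metric space and $\mathcal{F}$ is a collection of continuous maps $X\to X$. A semiconjugacy from $(X,\mathcal{F})$ to $(Y,\mathcal{G})$ is a pair $(\phi,h)$ where $\phi:X\to Y$ is a continuous surjective map and $h:\mathcal{F}\to\mathcal{G}$ is a surjective map such that $\phi(f(x))=h(f)(\phi(x))$ for all $x\in X$, $f\in\mathcal{F}$. $(X,\mathcal{F})$ is topologically transitive if for all nonempty open $U,V\subset X$ there exist $n\in\mathbb{N}=\{1,2,\dots\}$ and $f_1,\dots,f_n\in\mathcal{F}$ such that $f_n\circ\cdots\circ f_1(U)\cap V\neq\emptyset$. $(X,\mathcal{F})$ is strongly transitive if for every nonempty open $U\subset X$, $\bigcup_{n\in\mathbb{N},\ f_1,\dots,f_n\in\mathcal{F}} f_n\circ\cdots\circ f_1(U)=X$. *)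

(* Defs.v *)
From mathcomp Require Import all_boot all_order all_algebra.
From mathcomp Require Import all_classical all_reals all_analysis.

Set Implicit Arguments.
Unset Strict Implicit.
Unset Printing Implicit Defensive.

Local Open Scope classical_set_scope.

(* [metricType R] is not pointed, so the empty space is allowed; the family F
   may be empty too. *)
Definition is_gds (R : realType) (X : metricType R) (F : set (X -> X)) : Prop :=
  compact [set: X] /\ (forall f, F f -> continuous f).

(* [h] is a total function between the types of self-maps, but only its
   restriction to F, a map F -> G, is constrained. *)
Definition semiconjugacy (R : realType) (X Y : metricType R)
    (F : set (X -> X)) (G : set (Y -> Y))
    (phi : X -> Y) (h : (X -> X) -> (Y -> Y)) : Prop :=
  [/\ continuous phi, set_surj [set: X] [set: Y] phi,
      set_fun F G h, set_surj F G h
    & forall f, F f -> forall x, phi (f x) = h f (phi x)].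

(* f (n - 1) \o ... \o f 0 *)
Fixpoint iter_comp (X : Type) (f : nat -> X -> X) (n : nat) : X -> X :=
  if n is m.+1 then f m \o iter_comp f m else id.

Definition compositions (X : Type) (F : set (X -> X)) : set (X -> X) :=
  [set g | exists (n : nat) (f : nat -> X -> X),
    [/\ (0 < n)%N, forall i, (i < n)%N -> F (f i) & g = iter_comp f n]].

Definition topologically_transitive (R : realType) (X : metricType R)
    (F : set (X -> X)) : Prop :=
  forall U V : set X, open U -> U !=set0 -> open V -> V !=set0 ->
    exists2 g, compositions F g & (g @` U) `&` V !=set0.

Definition strongly_transitive (R : realType) (X : metricType R)
    (F : set (X -> X)) : Prop :=
  forall U : set X, open U -> U !=set0 ->
    \bigcup_(g in compositions F) (g @` U) = [set: X].

(* Main.v *)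
(* Compositions of maps of F descend along phi to compositions of their images
   under h, so an F-orbit from the pulled back open set phi^-1(U) is mapped by phi
   to a G-orbit from U. *)
Require Import Defs.
From mathcomp Require Import all_boot all_order all_algebra.
From mathcomp Require Import all_classical all_reals all_analysis.

Local Open Scope classical_set_scope.

(** Since [phi] is continuous and onto, nonempty open sets of Y pull back to nonempty open sets of X
    ([preimage_surj_nonempty]), where transitivity of F applies. By [compositions_semiconj], the
    composition [g] found there satisfies [phi \o g = k \o phi] pointwise for a composition [k] of
    G, so [phi] carries the conclusion back to Y. *)

Lemma iter_comp_semiconj (X Y : Type) (F : set (X -> X)) (phi : X -> Y)
    (h : (X -> X) -> Y -> Y) (f : nat -> X -> X) (n : nat) :
  (forall f, F f -> forall x, phi (f x) = h f (phi x)) ->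
  (forall i, (i < n)%N -> F (f i)) ->
  forall x, phi (iter_comp f n x) = iter_comp (h \o f) n (phi x).
Proof.
move=> phih; elim: n => //= n IHn Ff x.
rewrite phih; last exact: Ff.
by rewrite IHn // => i lt_in; apply: Ff; apply: ltnW.
Qed.

(** Replacing each factor [f i] by [h (f i)] keeps the length, hence its positivity. *)
Lemma compositions_semiconj (X Y : Type) (F : set (X -> X)) (G : set (Y -> Y))
    (phi : X -> Y) (h : (X -> X) -> Y -> Y) (g : X -> X) :
  set_fun F G h ->
  (forall f, F f -> forall x, phi (f x) = h f (phi x)) ->
  compositions F g ->
  exists2 k, compositions G k & forall x, phi (g x) = k (phi x).
Proof.
move=> hFG phih [n [f [n_gt0 Ff ->]]].
exists (iter_comp (h \o f) n); last exact: iter_comp_semiconj phih Ff.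
by exists n, (h \o f); split=> // i /Ff; apply: hFG.
Qed.

Lemma preimage_surj_nonempty (X Y : Type) (phi : X -> Y) (U : set Y) :
  set_surj [set: X] [set: Y] phi -> U !=set0 -> phi @^-1` U !=set0.
Proof. by move=> phiS [y Uy]; have [x _ xy] := phiS y I; exists x; rewrite /= xy. Qed.

Theorem theorem4p6 (R : realType) (X Y : metricType R)
    (F : set (X -> X)) (G : set (Y -> Y))
    (gdsF : is_gds F) (gdsG : is_gds G)
    (semi : exists (phi : X -> Y) (h : (X -> X) -> (Y -> Y)),
        semiconjugacy F G phi h) :
  (topologically_transitive F -> topologically_transitive G) /\
  (strongly_transitive F -> strongly_transitive G).
Proof.
have [phi [h [/continuousP phiC phiS hFG _ phih]]] := semi.
split=> [trF U V oU U0 oV V0|trF U oU U0].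
  (* Both U and V are pulled back: [phi x] lies in U and [phi (g x)] in V. *)
  have [g Fg [_ [[x Ux <-] Vgx]]] := trF _ _ (phiC _ oU)
    (preimage_surj_nonempty _ _ _ _ phiS U0) (phiC _ oV) (preimage_surj_nonempty _ _ _ _ phiS V0).
  have [k Gk gk] := compositions_semiconj _ _ _ _ _ _ _ hFG phih Fg.
  exists k => //; exists (k (phi x)); split; first by exists (phi x).
  by rewrite -gk.
apply/seteqP; split=> // y _.
(* It suffices to reach some lift [z] of [y] from the preimage of U. *)
have [z _ <-] := phiS y I.
have : [set: X] z by [].
(* Read backwards, strong transitivity turns the trivial membership of [z] in X into membership in
   the union of images. *)
rewrite -(trF _ (phiC _ oU) (preimage_surj_nonempty _ _ _ _ phiS U0)).
move=> [g Fg [x Ux <-]].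
have [k Gk gk] := compositions_semiconj _ _ _ _ _ _ _ hFG phih Fg.
by exists k => //; exists (phi x); rewrite // gk.
Qed.
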